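(* Let $\mathcal H$ be a two-sided quaternionic Hilbert space, let $\mathcal H_1$ be a right quaternionic Hilbert space, and let $$\begin{pmatrix}A&B\\ C&D\end{pmatrix}:\ \mathcal H_1\oplus\mathcal H\to\mathcal H_1\oplus\mathcal H$$ be a bounded operator. Let $\Phi$ be an $\mathbf L(\mathcal H)$-valued function, slice hyperholomorphic in an axially symmetric s-domain containing the origin, with realization $$\Phi(p)=D+p\,C\star(I_{\mathcal H_1}-pA)^{-\star}B ,$$ such that $$\mathrm{Re}\left(\begin{pmatrix}A&B\\ C&D\end{pmatrix}\begin{pmatrix}I_{\mathcal H_1}&0\\0&-I_{\mathcal H}\end{pmatrix}\right)\le 0 .$$ Then $\Phi$ is positive.
   Context: $\mathbb H$: quaternions; $\mathbb S$: purely imaginary unit quaternions; $\mathbb C_I=\mathbb R+I\mathbb R$; $[x+Iy]=\{x+Jy:J\in\mathbb S\}$; $\mathbb H_+=\{\mathrm{Re}\,p>0\}$. An s-domain is a domain $\Omega\subseteq\mathbb H$ meeting $\mathbb R$ such that each $\Omega\cap\mathbb C_I$ is a domain; axially symmetric means $q\in\Omega\Rightarrow[q]\subset\Omega$. A function with values in a two-sided quaternionic Banach space is slice hyperholomorphic if it is real differentiable and $(\partial_x+I\partial_y)f(x+Iy)=0$ on $\Omega\cap\mathbb C_I$ for all $I\in\mathbb S$ (right slice hyperholomorphic: $I$ on the right). $\mathrm{Re}\,T=\frac12(T+T^* )$. $D+pC\star(I-pA)^{-\star}B$ denotes the slice hyperholomorphic extension of $D+xC(I-xA)^{-1}B$ ($x$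 real); explicitly $D+p(C-\bar pCA)(I-2\mathrm{Re}(p)A+|p|^2A^2)^{-1}B$. $\Phi$ is positive if the kernel $K_\Phi(p,q)=\Phi(p)\star k(p,q)+k(p,q)\star_r\Phi(q)^*$ is positive definite for $p,q$ in the part of the domain lying in $\mathbb H_+$, where $k(p,q)=(\bar p+\bar q)(|p|^2+2\mathrm{Re}(p)\bar q+\bar q^2)^{-1}$. $K_\Phi$ is the kernel left slice hyperholomorphic in $p$ and right slice hyperholomorphic in $\bar q$ which equals $\frac{\Phi(x)+\Phi(y)^*}{x+y}$ for $p=x>0$, $q=y>0$ real. Positive definite means that all Hermitian matrices $(\langle K_\Phi(w_i,w_j)c_j,c_i\rangle)_{i,j=1}^N$, $c_i\in\mathcal H$, are nonnegative. *)

(* Defs.v *)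
From HB Require Import structures.
From mathcomp Require Import all_boot all_order all_algebra ring lra.
From mathcomp Require Import all_classical all_reals all_analysis.

Set Implicit Arguments.
Unset Strict Implicit.
Unset Printing Implicit Defensive.

Import Order.TTheory GRing.Theory Num.Theory.
Import numFieldNormedType.Exports.

Local Open Scope classical_set_scope.
Local Open Scope ring_scope.

(** * Quaternions *)

Record quat (R : Type) := Quat { qre : R; qi : R; qj : R; qk : R }.

Section QuatChoice.
Variable R : choiceType.

Definition tuple_of_quat (p : quat R) := (qre p, qi p, qj p, qk p).
Definition quat_of_tuple (t : R * R * R * R) :=
  let: (a, b, c, d) := t in Quat a b c d.

Lemma tuple_of_quatK : cancel tuple_of_quat quat_of_tuple.
Proof. by case. Qed.

HB.instance Definition _ := Choice.copy (quat R) (can_type tuple_of_quatK).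
End QuatChoice.

Section QuatAlgebra.
Variable R : realType.
Implicit Types p q r : quat R.

Lemma quatP p q :
  qre p = qre q -> qi p = qi q -> qj p = qj q -> qk p = qk q -> p = q.
Proof. by case: p => ????; case: q => ???? /= -> -> -> ->. Qed.

Definition addq p q :=
  Quat (qre p + qre q) (qi p + qi q) (qj p + qj q) (qk p + qk q).
Definition oppq p := Quat (- qre p) (- qi p) (- qj p) (- qk p).

Lemma addqA : associative addq.
Proof. by move=> p q r; apply: quatP => /=; rewrite addrA. Qed.
Lemma addqC : commutative addq.
Proof. by move=> p q; apply: quatP => /=; rewrite addrC. Qed.
Lemma add0q : left_id (Quat 0 0 0 0) addq.
Proof. by move=> p; apply: quatP => /=; rewrite add0r. Qed.
Lemma addNq : left_inverse (Quat 0 0 0 0) oppq addq.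
Proof. by move=> p; apply: quatP => /=; rewrite addNr. Qed.

HB.instance Definition _ :=
  GRing.isZmodule.Build (quat R) addqA addqC add0q addNq.

Definition mulq p q := Quat
  (qre p * qre q - qi p * qi q - qj p * qj q - qk p * qk q)
  (qre p * qi q + qi p * qre q + qj p * qk q - qk p * qj q)
  (qre p * qj q - qi p * qk q + qj p * qre q + qk p * qi q)
  (qre p * qk q + qi p * qj q - qj p * qi q + qk p * qre q).

Lemma mulqA : associative mulq.
Proof. by move=> p q r; apply: quatP => /=; ring. Qed.
Lemma mul1q : left_id (Quat 1 0 0 0) mulq.
Proof. by move=> p; apply: quatP => /=; ring. Qed.
Lemma mulq1 : right_id (Quat 1 0 0 0) mulq.
Proof. by move=> p; apply: quatP => /=; ring. Qed.
Lemma mulqDl : left_distributive mulq +%R.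
Proof. by move=> p q r; apply: quatP => /=; ring. Qed.
Lemma mulqDr : right_distributive mulq +%R.
Proof. by move=> p q r; apply: quatP => /=; ring. Qed.
Lemma oneq_neq0 : Quat 1 0 0 0 != 0 :> quat R.
Proof. by apply/eqP => -[/eqP]; rewrite oner_eq0. Qed.

HB.instance Definition _ := GRing.Zmodule_isNzRing.Build (quat R)
  mulqA mul1q mulq1 mulqDl mulqDr oneq_neq0.

Definition scaleq (a : R) p := Quat (a * qre p) (a * qi p) (a * qj p) (a * qk p).

Lemma scaleqA a b p : scaleq a (scaleq b p) = scaleq (a * b) p.
Proof. by apply: quatP => /=; ring. Qed.
Lemma scale1q : left_id 1 scaleq.
Proof. by move=> p; apply: quatP => /=; ring. Qed.
Lemma scaleqDr : right_distributive scaleq +%R.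
Proof. by move=> a p q; apply: quatP => /=; ring. Qed.
Lemma scaleqDl p : {morph scaleq^~ p : a b / a + b}.
Proof. by move=> a b; apply: quatP => /=; ring. Qed.

HB.instance Definition _ := GRing.Zmodule_isLmodule.Build R (quat R)
  scaleqA scale1q scaleqDr scaleqDl.

Lemma scaleqAl (a : R) p q : a *: (p * q) = (a *: p) * q.
Proof. by apply: quatP => /=; ring. Qed.
HB.instance Definition _ :=
  GRing.Lmodule_isLalgebra.Build R (quat R) scaleqAl.

Lemma scaleqAr (a : R) p q : a *: (p * q) = p * (a *: q).
Proof. by apply: quatP => /=; ring. Qed.
HB.instance Definition _ := GRing.Lalgebra_isAlgebra.Build R (quat R) scaleqAr.

Definition qconj p := Quat (qre p) (- qi p) (- qj p) (- qk p).
Definition qim p := Quat 0 (qi p) (qj p) (qk p).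

Definition qnorm2 p := qre p ^+ 2 + qi p ^+ 2 + qj p ^+ 2 + qk p ^+ 2.

Lemma qnorm2_ge0 p : 0 <= qnorm2 p.
Proof. by rewrite /qnorm2 !addr_ge0 ?sqr_ge0. Qed.

Lemma qnorm2_eq0 p : (qnorm2 p == 0) = (p == 0).
Proof.
rewrite /qnorm2 !paddr_eq0 ?addr_ge0 ?sqr_ge0// !sqrf_eq0.
apply/idP/eqP => [/andP[/andP[/andP[/eqP ? /eqP ?] /eqP ?] /eqP ?]|-> /=].
  exact: quatP.
by rewrite eqxx.
Qed.

Definition invq p := if p == 0 then p else (qnorm2 p)^-1 *: qconj p.

Definition unitq : {pred quat R} := fun p => p != 0.

Lemma mulVq : {in unitq, left_inverse 1 invq *%R}.
Proof.
move=> p pn0; rewrite /invq (negPf (pn0 : p != 0)).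
have : qnorm2 p != 0 by rewrite qnorm2_eq0.
by rewrite /qnorm2 => n0; apply: quatP => /=; field.
Qed.

Lemma mulqV : {in unitq, right_inverse 1 invq *%R}.
Proof.
move=> p pn0; rewrite /invq (negPf (pn0 : p != 0)).
have : qnorm2 p != 0 by rewrite qnorm2_eq0.
by rewrite /qnorm2 => n0; apply: quatP => /=; field.
Qed.

Lemma unitqP p q : q * p = 1 /\ p * q = 1 -> unitq p.
Proof.
case=> qp1 _; apply/eqP => p0; move: qp1; rewrite p0 mulr0 => /esym/eqP.
by rewrite oner_eq0.
Qed.

Lemma invq_out : {in [predC unitq], invq =1 id}.
Proof. by move=> p; rewrite inE /= negbK => /eqP ->; rewrite /invq eqxx. Qed.

HB.instance Definition _ :=
  GRing.NzRing_hasMulInverse.Build (quat R) mulVq mulqV unitqP invq_out.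

Definition qnorm p : R := Num.sqrt (qnorm2 p).

Lemma qnormD p q : qnorm (p + q) <= qnorm p + qnorm q.
Proof.
have np := sqrtr_ge0 (qnorm2 p); have nq := sqrtr_ge0 (qnorm2 q).
rewrite -[leRHS]ger0_norm ?addr_ge0// -sqrtr_sqr ler_wsqrtr//.
pose d := qre p * qre q + qi p * qi q + qj p * qj q + qk p * qk q.
have dle : d <= qnorm p * qnorm q.
  apply: (le_trans (ler_norm _)); rewrite -sqrtr_sqr -sqrtrM ?qnorm2_ge0//.
  apply: ler_wsqrtr; rewrite -subr_ge0 /d /qnorm2.
  have -> : (qre p ^+ 2 + qi p ^+ 2 + qj p ^+ 2 + qk p ^+ 2) *
     (qre q ^+ 2 + qi q ^+ 2 + qj q ^+ 2 + qk q ^+ 2) -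
     (qre p * qre q + qi p * qi q + qj p * qj q + qk p * qk q) ^+ 2 =
     (qre p * qi q - qi p * qre q) ^+ 2 + (qre p * qj q - qj p * qre q) ^+ 2 +
     (qre p * qk q - qk p * qre q) ^+ 2 + (qi p * qj q - qj p * qi q) ^+ 2 +
     (qi p * qk q - qk p * qi q) ^+ 2 + (qj p * qk q - qk p * qj q) ^+ 2 by ring.
  by rewrite !addr_ge0 ?sqr_ge0.
rewrite sqrrD !sqr_sqrtr ?qnorm2_ge0//.
rewrite [leLHS](_ : _ = qnorm2 p + d *+ 2 + qnorm2 q); last first.
  by rewrite /qnorm2 /d /=; ring.
by rewrite lerD2r lerD2l lerMn2r.
Qed.

Lemma qnormZ (a : R) p : qnorm (a *: p) = `|a| * qnorm p.
Proof.
rewrite /qnorm (_ : qnorm2 _ = a ^+ 2 * qnorm2 p); last first.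
  by rewrite /qnorm2 /=; ring.
by rewrite sqrtrM ?sqr_ge0// sqrtr_sqr.
Qed.

Lemma qnorm0_eq0 p : qnorm p = 0 -> p = 0.
Proof.
move/eqP; rewrite sqrtr_eq0 => pn; apply/eqP; rewrite -qnorm2_eq0.
by rewrite eq_le pn qnorm2_ge0.
Qed.

HB.instance Definition _ :=
  Lmodule_isNormed.Build R (quat R) qnormD qnormZ qnorm0_eq0.

End QuatAlgebra.

(** * Quaternionic Hilbert spaces *)

(* The real Banach space structure comes from the library; [qrmul v a] is the
   right multiplication v a.  The inner product is right linear in its first
   argument: <u a, v b> = conj(b) <u, v> a. *)
HB.mixin Record isRightQHilbert (R : realType) V & CompleteNormedModule R V := {
  qrmul : V -> quat R -> V ;
  inner : V -> V -> quat R ;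
  qrmulDl : forall u v a, qrmul (u + v) a = qrmul u a + qrmul v a ;
  qrmulDr : forall u a b, qrmul u (a + b) = qrmul u a + qrmul u b ;
  qrmulA : forall u a b, qrmul (qrmul u a) b = qrmul u (a * b) ;
  qrmul_real : forall u (x : R), qrmul u x%:A = x *: u ;
  innerDl : forall u v w, inner (u + v) w = inner u w + inner v w ;
  inner_qrmull : forall u v a, inner (qrmul u a) v = inner u v * a ;
  inner_conj : forall u v, inner v u = qconj (inner u v) ;
  inner_norm : forall u, inner u u = (`|u| ^+ 2)%:A
}.

#[short(type="rightQHilbertType")]
HB.structure Definition RightQHilbert (R : realType) :=
  {V of CompleteNormedModule R V & isRightQHilbert R V}.

(* [inner_qlmul] expresses that the left multiplication is compatible with the
   Hilbert structure; given the other axioms, it amounts to |a u| = |a| |u|. *)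
HB.mixin Record isTwoSidedQHilbert (R : realType) V & RightQHilbert R V := {
  qlmul : quat R -> V -> V ;
  qlmulDl : forall a b u, qlmul (a + b) u = qlmul a u + qlmul b u ;
  qlmulDr : forall a u v, qlmul a (u + v) = qlmul a u + qlmul a v ;
  qlmulA : forall a b u, qlmul a (qlmul b u) = qlmul (a * b) u ;
  qlmul_real : forall (x : R) u, qlmul x%:A u = x *: u ;
  qlmul_qrmul : forall a u b, qrmul (qlmul a u) b = qlmul a (qrmul u b) ;
  inner_qlmul : forall a u v, inner (qlmul a u) v = inner u (qlmul (qconj a) v)
}.

#[short(type="twoSidedQHilbertType")]
HB.structure Definition TwoSidedQHilbert (R : realType) :=
  {V of RightQHilbert R V & isTwoSidedQHilbert R V}.

(** * Orthogonal direct sum *)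

(* A record rather than a product: products carry the max norm. *)
Record hsum (U V : Type) := HSum { hfst : U ; hsnd : V }.

Section HSumChoice.
Variables U V : choiceType.

Definition pair_of_hsum (w : hsum U V) := (hfst w, hsnd w).
Definition hsum_of_pair (w : U * V) := HSum w.1 w.2.
Lemma pair_of_hsumK : cancel pair_of_hsum hsum_of_pair.
Proof. by case. Qed.

HB.instance Definition _ := Choice.copy (hsum U V) (can_type pair_of_hsumK).
End HSumChoice.

Section HSum.
Variables (R : realType) (U V : rightQHilbertType R).
Implicit Types w z t : hsum U V.

Lemma hsumP w z : hfst w = hfst z -> hsnd w = hsnd z -> w = z.
Proof. by case: w => ??; case: z => ?? /= -> ->. Qed.

Definition hsum_add w z := HSum (hfst w + hfst z) (hsnd w + hsnd z).
Definition hsum_opp w := HSum (- hfst w) (- hsnd w).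
Lemma hsum_addA : associative hsum_add.
Proof. by move=> w z t; apply: hsumP => /=; rewrite addrA. Qed.
Lemma hsum_addC : commutative hsum_add.
Proof. by move=> w z; apply: hsumP => /=; rewrite addrC. Qed.
Lemma hsum_add0 : left_id (HSum 0 0) hsum_add.
Proof. by move=> w; apply: hsumP => /=; rewrite add0r. Qed.
Lemma hsum_addN : left_inverse (HSum 0 0) hsum_opp hsum_add.
Proof. by move=> w; apply: hsumP => /=; rewrite addNr. Qed.

HB.instance Definition _ :=
  GRing.isZmodule.Build (hsum U V) hsum_addA hsum_addC hsum_add0 hsum_addN.

Definition hsum_scale (a : R) w := HSum (a *: hfst w) (a *: hsnd w).
Lemma hsum_scaleA a b w : hsum_scale a (hsum_scale b w) = hsum_scale (a * b) w.
Proof. by apply: hsumP => /=; rewrite scalerA. Qed.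
Lemma hsum_scale1 : left_id 1 hsum_scale.
Proof. by move=> w; apply: hsumP => /=; rewrite scale1r. Qed.
Lemma hsum_scaleDr : right_distributive hsum_scale +%R.
Proof. by move=> a w z; apply: hsumP => /=; rewrite scalerDr. Qed.
Lemma hsum_scaleDl w : {morph hsum_scale^~ w : a b / a + b}.
Proof. by move=> a b; apply: hsumP => /=; rewrite scalerDl. Qed.

HB.instance Definition _ := GRing.Zmodule_isLmodule.Build R (hsum U V)
  hsum_scaleA hsum_scale1 hsum_scaleDr hsum_scaleDl.

Definition hsum_norm w : R := Num.sqrt (`|hfst w| ^+ 2 + `|hsnd w| ^+ 2).

Lemma hsum_norm2_ge0 w : 0 <= `|hfst w| ^+ 2 + `|hsnd w| ^+ 2.
Proof. by rewrite addr_ge0 ?sqr_ge0. Qed.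

Lemma hsum_normD w z : hsum_norm (w + z) <= hsum_norm w + hsum_norm z.
Proof.
rewrite /hsum_norm /=; set u := hfst w; set v := hsnd w.
set u' := hfst z; set v' := hsnd z.
have nw := sqrtr_ge0 (`|u| ^+ 2 + `|v| ^+ 2).
have nz := sqrtr_ge0 (`|u'| ^+ 2 + `|v'| ^+ 2).
rewrite -[leRHS]ger0_norm ?addr_ge0// -sqrtr_sqr ler_wsqrtr//.
have dle : `|u| * `|u'| + `|v| * `|v'| <=
    Num.sqrt (`|u| ^+ 2 + `|v| ^+ 2) * Num.sqrt (`|u'| ^+ 2 + `|v'| ^+ 2).
  apply: (le_trans (ler_norm _)); rewrite -sqrtr_sqr -sqrtrM ?hsum_norm2_ge0//.
  apply: ler_wsqrtr; rewrite -subr_ge0.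
  have -> : (`|u| ^+ 2 + `|v| ^+ 2) * (`|u'| ^+ 2 + `|v'| ^+ 2) -
     (`|u| * `|u'| + `|v| * `|v'|) ^+ 2 = (`|u| * `|v'| - `|v| * `|u'|) ^+ 2.
    by ring.
  exact: sqr_ge0.
rewrite sqrrD !sqr_sqrtr ?hsum_norm2_ge0//.
apply: (@le_trans _ _ ((`|u| + `|u'|) ^+ 2 + (`|v| + `|v'|) ^+ 2)).
  by rewrite lerD// lerXn2r ?nnegrE ?addr_ge0 ?normr_ge0 ?ler_normD.
rewrite [leLHS](_ : _ = `|u| ^+ 2 + `|v| ^+ 2 +
  (`|u| * `|u'| + `|v| * `|v'|) *+ 2 + (`|u'| ^+ 2 + `|v'| ^+ 2)); last by ring.
by rewrite lerD2r lerD2l lerMn2r.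
Qed.

Lemma hsum_normZ (a : R) w : hsum_norm (a *: w) = `|a| * hsum_norm w.
Proof.
rewrite /hsum_norm /= !normrZ !exprMn -mulrDr sqrtrM ?sqr_ge0//.
by rewrite sqrtr_sqr normr_id.
Qed.

Lemma hsum_norm0_eq0 w : hsum_norm w = 0 -> w = 0.
Proof.
move/eqP; rewrite sqrtr_eq0 => w0.
have : `|hfst w| ^+ 2 + `|hsnd w| ^+ 2 == 0 by rewrite eq_le w0 hsum_norm2_ge0.
rewrite paddr_eq0 ?sqr_ge0// !sqrf_eq0 !normr_eq0 => /andP[/eqP u0 /eqP v0].
exact: hsumP.
Qed.

HB.instance Definition _ :=
  Lmodule_isNormed.Build R (hsum U V) hsum_normD hsum_normZ hsum_norm0_eq0.

Lemma hsum_normE w : `|w| = Num.sqrt (`|hfst w| ^+ 2 + `|hsnd w| ^+ 2).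
Proof. by []. Qed.

Lemma hfst_norm w : `|hfst w| <= `|w|.
Proof.
rewrite hsum_normE -[leLHS]ger0_norm ?normr_ge0// -sqrtr_sqr.
by rewrite ler_wsqrtr// lerDl sqr_ge0.
Qed.

Lemma hsnd_norm w : `|hsnd w| <= `|w|.
Proof.
rewrite hsum_normE -[leLHS]ger0_norm ?normr_ge0// -sqrtr_sqr.
by rewrite ler_wsqrtr// lerDr sqr_ge0.
Qed.

Lemma hsum_norm_le w : `|w| <= `|hfst w| + `|hsnd w|.
Proof.
rewrite hsum_normE -[leRHS]ger0_norm ?addr_ge0// -sqrtr_sqr.
by rewrite ler_wsqrtr// sqrrD lerD2r lerDl mulrn_wge0// mulr_ge0.
Qed.

Lemma hsum_complete (F : set_system (hsum U V)) :
  ProperFilter F -> cauchy F -> cvg F.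
Proof.
move=> FF Fc.
have cproj (W : completeNormedModType R) (f : hsum U V -> W) :
    (forall w z, `|f w - f z| <= `|w - z|) -> cvg (f @ F).
  move=> flip; apply: cauchy_cvg.
  apply: (@cauchy_exP _ _ (f @ F)) => e e0.
  have [w Fw] := (cauchyP F).1 Fc e e0.
  exists (f w); change (F (f @^-1` ball (f w) e)).
  apply: (filterS _ Fw) => z.
  by rewrite -!ball_normE /=; apply: le_lt_trans; exact: flip.
have /cvg_ex[l fl] : cvg (@hfst U V @ F).
  by apply: cproj => w z; exact: (hfst_norm (w - z)).
have /cvg_ex[m sm] : cvg (@hsnd U V @ F).
  by apply: cproj => w z; exact: (hsnd_norm (w - z)).
apply/cvg_ex; exists (HSum l m).
apply/cvgrPdist_le => e e0; have e20 : 0 < e / 2 by rewrite divr_gt0.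
move/cvgrPdist_le: fl => /(_ _ e20) fl; move/cvgrPdist_le: sm => /(_ _ e20) sm.
near=> w; rewrite (le_trans (hsum_norm_le _))//= (splitr e) lerD//.
  by near: w.
by near: w.
Unshelve. all: by end_near. Qed.

HB.instance Definition _ := Uniform_isComplete.Build (hsum U V) hsum_complete.

Definition hsum_qrmul w a := HSum (qrmul (hfst w) a) (qrmul (hsnd w) a).
Definition hsum_inner w z :=
  inner (hfst w) (hfst z) + inner (hsnd w) (hsnd z).

Lemma hsum_qrmulDl w z a :
  hsum_qrmul (w + z) a = hsum_qrmul w a + hsum_qrmul z a.
Proof. by apply: hsumP; rewrite /= qrmulDl. Qed.
Lemma hsum_qrmulDr w a b :
  hsum_qrmul w (a + b) = hsum_qrmul w a + hsum_qrmul w b.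
Proof. by apply: hsumP; rewrite /= qrmulDr. Qed.
Lemma hsum_qrmulA w a b :
  hsum_qrmul (hsum_qrmul w a) b = hsum_qrmul w (a * b).
Proof. by apply: hsumP; rewrite /= qrmulA. Qed.
Lemma hsum_qrmul_real w (x : R) : hsum_qrmul w x%:A = x *: w.
Proof. by apply: hsumP; rewrite /= qrmul_real. Qed.
Lemma hsum_innerDl w z t :
  hsum_inner (w + z) t = hsum_inner w t + hsum_inner z t.
Proof. by rewrite /hsum_inner /= !innerDl addrACA. Qed.
Lemma hsum_inner_qrmull w z a :
  hsum_inner (hsum_qrmul w a) z = hsum_inner w z * a.
Proof. by rewrite /hsum_inner /= !inner_qrmull mulrDl. Qed.
Lemma hsum_inner_conj w z : hsum_inner z w = qconj (hsum_inner w z).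
Proof.
rewrite /hsum_inner (inner_conj (hfst w)) (inner_conj (hsnd w)).
by apply: quatP => /=; rewrite ?opprD.
Qed.
Lemma hsum_inner_norm w : hsum_inner w w = (`|w| ^+ 2)%:A.
Proof.
by rewrite /hsum_inner !inner_norm hsum_normE sqr_sqrtr ?hsum_norm2_ge0// scalerDl.
Qed.

HB.instance Definition _ := isRightQHilbert.Build R (hsum U V)
  hsum_qrmulDl hsum_qrmulDr hsum_qrmulA hsum_qrmul_real hsum_innerDl
  hsum_inner_qrmull hsum_inner_conj hsum_inner_norm.
End HSum.

(** * Bounded right linear operators *)

Record bop (R : realType) (U V : rightQHilbertType R) := Bop {
  bop_fun :> U -> V ;
  bopD : forall u v, bop_fun (u + v) = bop_fun u + bop_fun v ;
  bop_qrmul : forall u a, bop_fun (qrmul u a) = qrmul (bop_fun u) a ;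
  bop_bounded : exists c : R, forall u, `|bop_fun u| <= c * `|u|
}.

HB.instance Definition _ (R : realType) (U V : rightQHilbertType R) :=
  gen_eqMixin (bop U V).
HB.instance Definition _ (R : realType) (U V : rightQHilbertType R) :=
  gen_choiceMixin (bop U V).

Section BopNormed.
Variables (R : realType) (U V : rightQHilbertType R).
Implicit Types S T : bop U V.

Lemma bopP S T : (forall u, S u = T u) -> S = T.
Proof.
case: S => f fD fq fb; case: T => g gD gq gb /= /funext fg.
by subst g; congr Bop; exact: Prop_irrelevance.
Qed.

Lemma qrmul0l (W : rightQHilbertType R) a : qrmul (0 : W) a = 0.
Proof.
by apply: (addrI (qrmul 0 a)); rewrite -qrmulDl !addr0.
Qed.

Lemma qrmulNl (W : rightQHilbertType R) (u : W) a : qrmul (- u) a = - qrmul u a.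
Proof.
by apply: (addrI (qrmul u a)); rewrite -qrmulDl !subrr qrmul0l.
Qed.

Lemma qrmulZl (W : rightQHilbertType R) x (u : W) a :
  qrmul (x *: u) a = x *: qrmul u a.
Proof.
by rewrite -!qrmul_real !qrmulA -scalerAl -scalerAr mul1r mulr1.
Qed.

Lemma bopZ T x u : T (x *: u) = x *: T u.
Proof. by rewrite -!qrmul_real bop_qrmul. Qed.

Lemma bop0 T : T 0 = 0.
Proof. by rewrite -(scale0r 0) bopZ scale0r. Qed.

Definition bop_zero : bop U V.
Proof.
apply: (@Bop _ _ _ (fun=> 0)) => [u v|u a|]; rewrite ?addr0 ?qrmul0l//.
by exists 0 => u; rewrite normr0 mul0r.
Defined.

Definition bop_add S T : bop U V.
Proof.
apply: (@Bop _ _ _ (fun u => S u + T u)) => [u v|u a|].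
- by rewrite !bopD addrACA.
- by rewrite !bop_qrmul qrmulDl.
- have [c Sc] := bop_bounded S; have [d Td] := bop_bounded T.
  by exists (c + d) => u; rewrite mulrDl (le_trans (ler_normD _ _)) ?lerD.
Defined.

Definition bop_scale (x : R) T : bop U V.
Proof.
apply: (@Bop _ _ _ (fun u => x *: T u)) => [u v|u a|].
- by rewrite bopD scalerDr.
- by rewrite bop_qrmul qrmulZl.
- have [c Tc] := bop_bounded T.
  by exists (`|x| * c) => u; rewrite normrZ -mulrA ler_wpM2l.
Defined.

Definition bop_opp T : bop U V.
Proof.
apply: (@Bop _ _ _ (fun u => - T u)) => [u v|u a|].
- by rewrite bopD opprD.
- by rewrite bop_qrmul qrmulNl.
- by have [c Tc] := bop_bounded T; exists c => u; rewrite normrN.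
Defined.

Lemma bop_addA : associative bop_add.
Proof. by move=> S T W; apply: bopP => u /=; rewrite addrA. Qed.
Lemma bop_addC : commutative bop_add.
Proof. by move=> S T; apply: bopP => u /=; rewrite addrC. Qed.
Lemma bop_add0 : left_id bop_zero bop_add.
Proof. by move=> S; apply: bopP => u /=; rewrite add0r. Qed.
Lemma bop_addN : left_inverse bop_zero bop_opp bop_add.
Proof. by move=> S; apply: bopP => u /=; rewrite addNr. Qed.

HB.instance Definition _ :=
  GRing.isZmodule.Build (bop U V) bop_addA bop_addC bop_add0 bop_addN.

Lemma bop_scaleA x y T : bop_scale x (bop_scale y T) = bop_scale (x * y) T.
Proof. by apply: bopP => u /=; rewrite scalerA. Qed.
Lemma bop_scale1 : left_id 1 bop_scale.
Proof. by move=> T; apply: bopP => u /=; rewrite scale1r. Qed.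
Lemma bop_scaleDr : right_distributive bop_scale +%R.
Proof. by move=> x S T; apply: bopP => u /=; rewrite scalerDr. Qed.
Lemma bop_scaleDl T : {morph bop_scale^~ T : x y / x + y}.
Proof. by move=> x y; apply: bopP => u /=; rewrite scalerDl. Qed.

HB.instance Definition _ := GRing.Zmodule_isLmodule.Build R (bop U V)
  bop_scaleA bop_scale1 bop_scaleDr bop_scaleDl.

Definition opnorm T : R := sup [set `|T u| | u in [set u | `|u| <= 1]].

Lemma opnorm_has_sup T : has_sup [set `|T u| | u in [set u | `|u| <= 1]].
Proof.
split; first by exists `|T 0|, 0 => //=; rewrite normr0.
have [c Tc] := bop_bounded T; exists (`|c|) => _ [u /= u1 <-].
apply: (le_trans (Tc u)); apply: (@le_trans _ _ (`|c| * `|u|)).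
  by rewrite ler_wpM2r// ler_norm.
by rewrite ler_piMr.
Qed.

Lemma opnorm_ge0 T : 0 <= opnorm T.
Proof.
apply: (le_trans (normr_ge0 (T 0))); apply: sup_upper_bound.
  exact: opnorm_has_sup.
by exists 0 => //=; rewrite normr0.
Qed.

Lemma opnormP T u : `|T u| <= opnorm T * `|u|.
Proof.
have [->|u0] := eqVneq u 0; first by rewrite bop0 !normr0 mulr0.
have nu : 0 < `|u| by rewrite normr_gt0.
rewrite -ler_pdivrMr// mulrC -[X in X * _]ger0_norm ?invr_ge0// -normrZ -bopZ.
apply: sup_upper_bound; first exact: opnorm_has_sup.
by exists (`|u|^-1 *: u) => //=; rewrite normrZ normfV normr_id mulVf ?gt_eqF.
Qed.

Lemma opnorm_le T c : 0 <= c -> (forall u, `|T u| <= c * `|u|) -> opnorm T <= c.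
Proof.
move=> c0 Tc; apply: ge_sup; first by case: (opnorm_has_sup T).
by move=> _ [u /= u1 <-]; apply: (le_trans (Tc u)); rewrite ler_piMr.
Qed.

Lemma opnormD S T : opnorm (S + T) <= opnorm S + opnorm T.
Proof.
apply: opnorm_le => [|u]; first by rewrite addr_ge0 ?opnorm_ge0.
by rewrite mulrDl (le_trans (ler_normD _ _)) ?lerD ?opnormP.
Qed.

Lemma opnormZ_le x T : opnorm (x *: T) <= `|x| * opnorm T.
Proof.
apply: opnorm_le => [|u]; first by rewrite mulr_ge0 ?opnorm_ge0.
by rewrite [leLHS]normrZ -mulrA ler_wpM2l ?opnormP.
Qed.

Lemma opnormZ x T : opnorm (x *: T) = `|x| * opnorm T.
Proof.
apply/eqP; rewrite eq_le opnormZ_le/=.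
have [->|x0] := eqVneq x 0; first by rewrite normr0 mul0r opnorm_ge0.
rewrite -ler_pdivlMl ?normr_gt0// -normfV.
by apply: (le_trans _ (opnormZ_le _ _)); rewrite scalerA mulVf// scale1r.
Qed.

Lemma opnorm0_eq0 T : opnorm T = 0 -> T = 0.
Proof.
move=> T0; apply: bopP => u; apply/eqP; rewrite -normr_le0.
by rewrite (le_trans (opnormP _ _))// T0 mul0r.
Qed.

HB.instance Definition _ :=
  Lmodule_isNormed.Build R (bop U V) opnormD opnormZ opnorm0_eq0.
End BopNormed.

Section BopOperations.
Variable R : realType.
Implicit Types U V W : rightQHilbertType R.

Definition bop_id U : bop U U.
Proof.
by apply: (@Bop _ _ _ id) => //; exists 1 => u; rewrite mul1r.
Defined.

Definition bop_comp U V W (S : bop V W) (T : bop U V) : bop U W.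
Proof.
apply: (@Bop _ _ _ (S \o T)) => [u v|u a|] /=; rewrite ?bopD ?bop_qrmul//.
exists (opnorm S * opnorm T) => u; rewrite (le_trans (opnormP _ _))//.
by rewrite -mulrA ler_wpM2l ?opnorm_ge0 ?opnormP.
Defined.

(* The block operator ((A, B), (C, D)) from U1 (+) U2 to V1 (+) V2. *)
Definition bop_block U1 U2 V1 V2 (A : bop U1 V1) (B : bop U2 V1)
  (C : bop U1 V2) (D : bop U2 V2) : bop (hsum U1 U2) (hsum V1 V2).
Proof.
apply: (@Bop _ _ _ (fun w : hsum U1 U2 =>
  HSum (A (hfst w) + B (hsnd w)) (C (hfst w) + D (hsnd w)))) => [w z|w a|].
- by apply: hsumP => /=; rewrite !bopD addrACA.
- by apply: hsumP => /=; rewrite !bop_qrmul qrmulDl.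
- exists (opnorm A + opnorm B + (opnorm C + opnorm D)) => w.
  have bd X1 X2 Y (S : bop X1 Y) (T : bop X2 Y) (z : hsum X1 X2) :
      `|S (hfst z) + T (hsnd z)| <= (opnorm S + opnorm T) * `|z|.
    rewrite mulrDl (le_trans (ler_normD _ _))// lerD//.
      by rewrite (le_trans (opnormP _ _))// ler_wpM2l ?opnorm_ge0 ?hfst_norm.
    by rewrite (le_trans (opnormP _ _))// ler_wpM2l ?opnorm_ge0 ?hsnd_norm.
  by rewrite (le_trans (hsum_norm_le _))//= mulrDl lerD ?bd.
Defined.

(* The operator T^*; it exists by the Riesz representation theorem, and it is
   unique since the inner product is nondegenerate. *)
Definition adjoint U V (T : bop U V) : bop V U :=
  get [set S : bop V U | forall u v, inner (T u) v = inner u (S v)].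

Definition bop_re U (T : bop U U) : bop U U := 2^-1 *: (T + adjoint T).

Definition nonneg_quat (a : quat R) := 0 <= qre a /\ a = (qre a)%:A.

Definition bop_le0 U (T : bop U U) :=
  forall u, nonneg_quat (- inner (T u) u).

Lemma qlmul_norm (H : twoSidedQHilbertType R) a (u : H) :
  `|qlmul a u| = `|a| * `|u|.
Proof.
have E : (`|qlmul a u| ^+ 2)%:A = ((`|a| * `|u|) ^+ 2)%:A :> quat R.
  rewrite -inner_norm inner_qlmul qlmulA.
  have -> : qconj a * a = (`|a| ^+ 2)%:A.
    rewrite [`|a|]/(qnorm a) /qnorm sqr_sqrtr ?qnorm2_ge0// /qnorm2.
    by apply: quatP => /=; ring.
  rewrite qlmul_real -qrmul_real inner_conj inner_qrmull inner_norm.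
  by apply: quatP => /=; ring.
have {E} : `|qlmul a u| ^+ 2 = (`|a| * `|u|) ^+ 2.
  by have [] := E; rewrite !mulr1.
by move/eqP; rewrite eqrXn2 ?mulr_ge0// => /eqP.
Qed.

Definition qlmul_bop (H : twoSidedQHilbertType R) (a : quat R) : bop H H.
Proof.
apply: (@Bop _ _ _ (qlmul a)) => [u v|u b|].
- by rewrite qlmulDr.
- by rewrite qlmul_qrmul.
- by exists `|a| => u; rewrite qlmul_norm.
Defined.

End BopOperations.

Arguments bop_id {R} U.
Arguments qlmul_bop {R} H a.

Notation "S '*o' T" := (bop_comp S T)
  (at level 40, left associativity) : ring_scope.

(** * Slice hyperholomorphic operator-valued functions *)

Section Slice.
Variables (R : realType) (H : twoSidedQHilbertType R).
Implicit Types (Omega : set (quat R)) (f g Phi : quat R -> bop H H).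

(* The sphere of imaginary units. *)
Definition qsphere : set (quat R) := [set I | qre I = 0 /\ `|I| = 1].

Definition slice_point (x y : R) (I : quat R) : quat R := x%:A + y *: I.

Definition domain (T : topologicalType) (E : set T) :=
  [/\ open E, connected E & E !=set0].

(* The slice Omega `&` C_I is read in the coordinates (x, y) of C_I. *)
Definition s_domain Omega :=
  [/\ domain Omega, exists x : R, Omega x%:A &
      forall I, qsphere I ->
        domain [set z : R * R | Omega (slice_point z.1 z.2 I)]].

Definition axially_symmetric Omega :=
  forall x y I J, qsphere I -> qsphere J ->
    Omega (slice_point x y I) -> Omega (slice_point x y J).

(* ['D_1 f] and ['D_I f] are the derivatives with respect to x and y of
   f (x + I y). *)
Definition slice_hyperholomorphic Omega f :=
  (forall p, Omega p -> differentiable f p) /\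
  (forall I x y, qsphere I -> Omega (slice_point x y I) ->
     'D_1 f (slice_point x y I) +
     qlmul_bop H I *o 'D_I f (slice_point x y I) = 0).

(* An imaginary unit I such that p = Re p + |Im p| I. *)
Definition imag_unit (p : quat R) : quat R :=
  if qim p == 0 then Quat 0 1 0 0 else `|qim p|^-1 *: qim p.

(* Writing p = x + I y with I = imag_unit p, a left slice hyperholomorphic f
   is f p = f0 + I f1 and f (conj p) = f0 - I f1, with f0, f1 depending on
   (x, y) only. *)
Definition lslice0 f p := 2^-1 *: (f p + f (qconj p)).
Definition lslice1 f p :=
  qlmul_bop H (- imag_unit p) *o (2^-1 *: (f p - f (qconj p))).

Definition lstar f g (p : quat R) : bop H H :=
  (lslice0 f p *o lslice0 g p - lslice1 f p *o lslice1 g p) +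
  qlmul_bop H (imag_unit p) *o
    (lslice0 f p *o lslice1 g p + lslice1 f p *o lslice0 g p).

(* The same for functions which are right slice hyperholomorphic in conj q:
   with q = x + I y, f q = f0 + f1 conj(I). *)
Definition rslice0 f q := 2^-1 *: (f q + f (qconj q)).
Definition rslice1 f q :=
  (2^-1 *: (f q - f (qconj q))) *o qlmul_bop H (imag_unit q).

Definition rstar f g (q : quat R) : bop H H :=
  (rslice0 f q *o rslice0 g q - rslice1 f q *o rslice1 g q) +
  (rslice0 f q *o rslice1 g q + rslice1 f q *o rslice0 g q) *o
    qlmul_bop H (qconj (imag_unit q)).

(** * Positive functions *)

Definition khalf (p q : quat R) : quat R :=
  (qconj p + qconj q) *
  ((`|p| ^+ 2)%:A + (2 * qre p) *: qconj q + qconj q ^+ 2)^-1.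

(* Scalar kernels act on H by left multiplication, in accordance with the
   two-sided structure (a T) v = a (T v), (T a) v = T (a v) of L(H). *)
Definition kernel_Phi Phi (p q : quat R) : bop H H :=
  lstar Phi (fun p' => qlmul_bop H (khalf p' q)) p +
  rstar (fun q' => qlmul_bop H (khalf p q')) (fun q' => adjoint (Phi q')) q.

Definition nonneg_mx N (M : 'M[quat R]_N) :=
  (forall i j, M i j = qconj (M j i)) /\
  (forall a : 'I_N -> quat R,
     nonneg_quat (\sum_i \sum_j qconj (a i) * M i j * a j)).

Definition positive_definite (E : set (quat R))
    (K : quat R -> quat R -> bop H H) :=
  forall N (w : 'I_N -> quat R) (c : 'I_N -> H), (forall i, E (w i)) ->
    nonneg_mx (\matrix_(i, j) inner (K (w i) (w j) (c j)) (c i)).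

Definition positive_function Omega Phi :=
  positive_definite [set p | Omega p /\ 0 < qre p] (kernel_Phi Phi).

(** * Realizations *)

Definition bop_inverse (U : rightQHilbertType R) (S T : bop U U) :=
  S *o T = bop_id U /\ T *o S = bop_id U.

(* Phi p = D + p C * (I - p A)^{-*} B in closed form, at every point of Omega
   where I - 2 Re(p) A + |p|^2 A^2 has a bounded inverse S.  This is the case
   near 0, hence the realization determines a slice hyperholomorphic Phi. *)
Definition realization (H1 : rightQHilbertType R) Omega Phi (A : bop H1 H1)
    (B : bop H H1) (C : bop H1 H) (D : bop H H) :=
  forall p, Omega p -> forall S : bop H1 H1,
    bop_inverse S
      (bop_id H1 - (2 * qre p) *: A + (`|p| ^+ 2) *: (A *o A)) ->
    Phi p = D + qlmul_bop H p *o
              (C - qlmul_bop H (qconj p) *o C *o A) *o S *o B.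

End Slice.

(* Main.v *)
Require Import Defs.
From mathcomp Require Import all_boot all_order all_algebra ring lra.
From mathcomp Require Import all_classical all_reals all_analysis.

Set Implicit Arguments.
Unset Strict Implicit.
Unset Printing Implicit Defensive.

Import Order.TTheory GRing.Theory Num.Theory.
Import numFieldNormedType.Exports.

Local Open Scope classical_set_scope.
Local Open Scope ring_scope.

(** On the positive real axis the theorem is the usual colligation argument.
    Write [M] for the block operator, [J = diag(1, -1)] and
    [F(x) = C (1 - x A)^-1].  Since [F(x) - x F(x) A = C], the adjoint of [M]
    maps [v_x(d) = (x F(x)^* d, d)] to [(F(x)^* d, Phi(x)^* d)].  Expanding the
    form [<J v_y(c), M^* v_x(d)> + <M^* v_y(c), J v_x(d)>], which is nonpositive
    on the diagonal by hypothesis, one finds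
      [Phi(x) + Phi(y)^* = (x + y) F(x) F(y)^* + N(x, y)]
    with [N] a positive kernel; division by [x + y] leaves [F(x) F(y)^*] plus
    the product of two positive kernels.

    Off the real axis the division becomes the solution of a Sylvester equation.
    The scalar kernel [khalf] satisfies [p k + k conj(q) = 1], and since
    multiplication by the variable commutes with the star products, the kernel
    satisfies [p K(p, q) + K(p, q) conj(q) = Phi(p) + Phi(q)^*]
    ([kernel_Phi_sylvester]).  The colligation identity survives with
    [F(p) = (C - conj(p) C A) (1 - 2 Re(p) A + |p|^2 A^2)^-1], because
    [F(p) - p F(p) A = C] ([star_resolventP], [adjoint_block]).  Hence
    [X(p, q) = K(p, q) - F(p) F(q)^*] solves [p X + X conj(q) = N(p, q)], and a
    Lyapunov argument ([lyapunov_ge0]) shows that such a solution is a positive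
    kernel on the right half-space: the Cayley transform turns the equation into
    [X = Z X Z^* + (positive)] with [Z] a strict contraction.  Hermitian
    symmetry of [K] follows from the uniqueness of solutions ([sylvester_inj]).

    Two facts of Hilbert space theory enter: existence of adjoints (Riesz) and
    invertibility of coercive operators (Lax--Milgram), both consequences of one
    variational lemma ([energy_solution]).  The second gives the inverse in
    [F(p)], because the hypothesis makes [A] dissipative
    ([dissipative_inverse_exists]). *)

(** * Quaternions and the real inner product *)

Section Quaternions.
Variable R : realType.
Implicit Types (p q : quat R) (x : R).

Lemma qreD p q : qre (p + q) = qre p + qre q. Proof. by []. Qed.
Lemma qreN p : qre (- p) = - qre p. Proof. by []. Qed.

Lemma qre_sum I (r : seq I) (P : pred I) (F : I -> quat R) :
  qre (\sum_(i <- r | P i) F i) = \sum_(i <- r | P i) qre (F i).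
Proof. exact: (big_morph _ qreD). Qed.

Lemma qconjK : involutive (@qconj R).
Proof. by move=> p; apply: quatP => /=; rewrite ?opprK. Qed.

Lemma qconjD p q : qconj (p + q) = qconj p + qconj q.
Proof. by apply: quatP => /=; rewrite ?opprD. Qed.

Lemma qconjM p q : qconj (p * q) = qconj q * qconj p.
Proof. by apply: quatP => /=; ring. Qed.

Lemma normqE p : `|p| = Num.sqrt (qnorm2 p).
Proof. by []. Qed.

Lemma sqr_normq p : `|p| ^+ 2 = qnorm2 p.
Proof. by rewrite normqE sqr_sqrtr ?qnorm2_ge0. Qed.

Lemma normqM p q : `|p * q| = `|p| * `|q|.
Proof.
rewrite !normqE -sqrtrM ?qnorm2_ge0//; congr Num.sqrt.
by rewrite /qnorm2 /=; ring.
Qed.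

Lemma sqr_qre_le p : qre p ^+ 2 <= `|p| ^+ 2.
Proof. by rewrite sqr_normq /qnorm2 -!addrA lerDl !addr_ge0 ?sqr_ge0. Qed.

Lemma qre_gt0_neq0 p : 0 < qre p -> p != 0.
Proof. by move=> p0; apply/eqP => pE; rewrite pE ltxx in p0. Qed.

Lemma qmulV p : p != 0 -> p * p^-1 = 1.
Proof. by move=> p0; apply: divrr. Qed.

Lemma qmulVl p : p != 0 -> p^-1 * p = 1.
Proof. by move=> p0; apply: mulVr. Qed.

(** The Cayley transform maps the right half-space into the open unit ball. *)
Lemma cayley_lt1 p : 0 < qre p -> `|(1 - p) * (1 + p)^-1| < 1.
Proof.
move=> p0; have np : 0 < `|1 + p|.
  by rewrite normr_gt0 qre_gt0_neq0//= ltr_wpDl.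
rewrite -(ltr_pM2r np) mul1r -normqM -mulrA mulVr ?mulr1; last first.
  by rewrite normr_gt0 in np.
rewrite -(ltr_pXn2r (n := 2)) ?nnegrE ?normr_ge0// !sqr_normq /qnorm2 /=; nra.
Qed.

(** The quadratic has real coefficients and vanishes exactly on the sphere of
    [- p], which lies in the left half-space. *)
Lemma companion_neq0 p q : 0 < qre p -> 0 < qre q ->
  (`|p| ^+ 2)%:A + (2 * qre p) *: q + q ^+ 2 != 0.
Proof.
move=> p0 q0; apply/eqP => E.
move: (congr1 (@qre R) E) (congr1 (@qi R) E) (congr1 (@qj R) E)
  (congr1 (@qk R) E) => /=.
rewrite sqr_normq /qnorm2.
move: p q p0 q0 {E} => [a b c d] [x y z w] /= a0 x0 E1 E2 E3 E4.
have ax : 0 < a + x by rewrite addr_gt0.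
have Y : y = 0.
  suff : (a + x) * y = 0 by move/eqP; rewrite mulf_eq0 gt_eqF//= => /eqP.
  lra.
have Z : z = 0.
  suff : (a + x) * z = 0 by move/eqP; rewrite mulf_eq0 gt_eqF//= => /eqP.
  lra.
have W : w = 0.
  suff : (a + x) * w = 0 by move/eqP; rewrite mulf_eq0 gt_eqF//= => /eqP.
  lra.
rewrite Y Z W in E1.
by nra.
Qed.

End Quaternions.

Section RealInner.
Variable R : realType.
Implicit Types (U V W : rightQHilbertType R).

Definition reinner U (u v : U) : R := qre (inner u v).

Lemma innerDr U (u v w : U) : inner w (u + v) = inner w u + inner w v.
Proof. by rewrite inner_conj innerDl qconjD -!inner_conj. Qed.

Lemma inner_qrmulr U (u v : U) a : inner u (qrmul v a) = qconj a * inner u v.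
Proof. by rewrite inner_conj inner_qrmull qconjM -inner_conj. Qed.

Lemma innerZl U x (u v : U) : inner (x *: u) v = x *: inner u v.
Proof. by rewrite -qrmul_real inner_qrmull -scalerAr mulr1. Qed.

Lemma innerZr U x (u v : U) : inner u (x *: v) = x *: inner u v.
Proof.
by rewrite inner_conj innerZl [in RHS]inner_conj; apply: quatP => /=; ring.
Qed.

Lemma innerNl U (u v : U) : inner (- u) v = - inner u v.
Proof. by rewrite -scaleN1r innerZl scaleN1r. Qed.

Lemma innerNr U (u v : U) : inner u (- v) = - inner u v.
Proof. by rewrite -scaleN1r innerZr scaleN1r. Qed.

Lemma inner0l U (u : U) : inner 0 u = 0.
Proof. by rewrite -(scale0r 0) innerZl scale0r. Qed.

Lemma inner0r U (u : U) : inner u 0 = 0.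
Proof. by rewrite -(scale0r 0) innerZr scale0r. Qed.

Lemma inner_hsum U V (w z : hsum U V) :
  inner w z = inner (hfst w) (hfst z) + inner (hsnd w) (hsnd z).
Proof. by []. Qed.

Lemma inner_suml U I (r : seq I) (P : pred I) (F : I -> U) v :
  inner (\sum_(i <- r | P i) F i) v = \sum_(i <- r | P i) inner (F i) v.
Proof.
by apply: (big_morph (fun u => inner u v)) => [u w|]; rewrite ?innerDl ?inner0l.
Qed.

Lemma inner_sumr U I (r : seq I) (P : pred I) (F : I -> U) v :
  inner v (\sum_(i <- r | P i) F i) = \sum_(i <- r | P i) inner v (F i).
Proof.
by apply: (big_morph (inner v)) => [u w|]; rewrite ?innerDr ?inner0r.
Qed.

Lemma reinner_sum U (I K : finType) (u : I -> U) (v : K -> U) :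
  reinner (\sum_i u i) (\sum_k v k) = \sum_k \sum_i reinner (u i) (v k).
Proof.
rewrite /reinner inner_sumr qre_sum; apply: eq_bigr => k _.
by rewrite inner_suml qre_sum.
Qed.

Lemma reinnerC U (u v : U) : reinner u v = reinner v u.
Proof. by rewrite /reinner inner_conj. Qed.

Lemma reinnerDl U (u v w : U) : reinner (u + v) w = reinner u w + reinner v w.
Proof. by rewrite /reinner innerDl. Qed.

Lemma reinnerDr U (u v w : U) : reinner w (u + v) = reinner w u + reinner w v.
Proof. by rewrite /reinner innerDr. Qed.

Lemma reinnerZl U x (u v : U) : reinner (x *: u) v = x * reinner u v.
Proof. by rewrite /reinner innerZl. Qed.

Lemma reinnerZr U x (u v : U) : reinner u (x *: v) = x * reinner u v.
Proof. by rewrite /reinner innerZr. Qed.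

Lemma reinnerNl U (u v : U) : reinner (- u) v = - reinner u v.
Proof. by rewrite /reinner innerNl. Qed.

Lemma reinnerNr U (u v : U) : reinner u (- v) = - reinner u v.
Proof. by rewrite /reinner innerNr. Qed.

Lemma reinner0r U (u : U) : reinner u 0 = 0.
Proof. by rewrite /reinner inner0r. Qed.

Lemma reinner_norm U (u : U) : reinner u u = `|u| ^+ 2.
Proof. by rewrite /reinner inner_norm /= mulr1. Qed.

Lemma normD_reinner U (u v : U) :
  `|u + v| ^+ 2 = `|u| ^+ 2 + 2 * reinner u v + `|v| ^+ 2.
Proof.
rewrite -!reinner_norm reinnerDl !reinnerDr (reinnerC v u); ring.
Qed.

Lemma reinner_le U (u v : U) : `|reinner u v| <= `|u| * `|v|.
Proof.
have [->|v0] := eqVneq v 0.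
  by rewrite /reinner inner0r !normr0 mulr0.
have n0 : 0 < `|v| by rewrite normr_gt0.
rewrite -[leRHS]ger0_norm ?mulr_ge0// -[leLHS]normr_id.
rewrite -!sqrtr_sqr ler_wsqrtr// sqrtr_sqr real_normK ?num_real//.
have := sqr_ge0 `|u + (- (reinner u v / `|v| ^+ 2)) *: v|.
rewrite normD_reinner reinnerZr normrZ exprMn real_normK ?num_real// => h.
rewrite -subr_ge0 (_ : _ - _ = `|v| ^+ 2 * (`|u| ^+ 2 +
   2 * (- (reinner u v / `|v| ^+ 2) * reinner u v) +
   (- (reinner u v / `|v| ^+ 2)) ^+ 2 * `|v| ^+ 2)); last first.
  by field; rewrite gt_eqF.
by rewrite mulr_ge0// sqr_ge0.
Qed.

Lemma reinner_eqr U (u v : U) : (forall w, reinner w u = reinner w v) -> u = v.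
Proof.
move=> h; apply/eqP; rewrite -subr_eq0 -normr_eq0 -sqrf_eq0 -reinner_norm.
by rewrite reinnerDr reinnerNr h subrr.
Qed.

Lemma inner_eqr U (u v : U) : (forall w, inner w u = inner w v) -> u = v.
Proof.
by move=> h; apply/reinner_eqr => w; rewrite /reinner h.
Qed.

Lemma bopN U V (T : bop U V) u : T (- u) = - T u.
Proof. by rewrite -scaleN1r bopZ scaleN1r. Qed.

Lemma bop_sum U V (T : bop U V) I (r : seq I) (P : pred I) (F : I -> U) :
  T (\sum_(i <- r | P i) F i) = \sum_(i <- r | P i) T (F i).
Proof. by apply: big_morph; [exact: bopD | exact: bop0]. Qed.

Lemma bopB U V (T : bop U V) u v : T (u - v) = T u - T v.
Proof. by rewrite bopD bopN. Qed.

End RealInner.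

(** Linear identities between vectors become scalar identities between their
    inner products with a test vector. *)
Ltac vector_field :=
  let t := fresh in
  apply: reinner_eqr => t;
  rewrite ?(reinnerDr, reinnerNr, reinnerZr, reinner0r); field.

(** * Riesz representation, adjoints and inverses *)

Section Adjoint.
Variable R : realType.
Implicit Types (U V W : rightQHilbertType R).

(** A minimising sequence of [|T u|^2 - 2 phi u] satisfies the Euler equation
    of its minimum up to smaller and smaller errors; those errors control the
    distances between approximate solutions, so completeness applies.  [T = id]
    gives the Riesz theorem, and [phi = reinner f (T _)] the surjectivity of
    coercive operators. *)
Lemma energy_solution U V (T : bop U V) (phi : U -> R) (a c : R) :
  0 < a -> (forall u, a * `|u| <= `|T u|) ->
  (forall u v, phi (u + v) = phi u + phi v) ->
  (forall x u, phi (x *: u) = x * phi u) ->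
  (forall u, `|phi u| <= c * `|u|) ->
  exists u, forall v, reinner (T u) (T v) = phi v.
Proof.
move=> a0 Ta phiD phiZ phic.
pose E u := `|T u| ^+ 2 - 2 * phi u.
have E_lb u : - (c / a) ^+ 2 <= E u.
  have h1 : phi u <= `|c| / a * `|T u|.
    rewrite (le_trans (ler_norm _))// (le_trans (phic u))//.
    rewrite (@le_trans _ _ (`|c| * `|u|)) ?ler_wpM2r ?ler_norm// -mulrA.
    by rewrite ler_wpM2l// mulrC ler_pdivlMr// mulrC.
  have h2 := sqr_ge0 (`|T u| - `|c| / a).
  have : (`|c| / a) ^+ 2 = (c / a) ^+ 2.
    by rewrite !expr_div_n real_normK ?num_real.
  by rewrite /E; lra.
have Einf : has_inf (range E).
  split; first by exists (E 0), 0.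
  by exists (- (c / a) ^+ 2) => _ [u _ <-].
have ET u v t : E (u + t *: v) =
    E u + 2 * t * (reinner (T u) (T v) - phi v) + t ^+ 2 * `|T v| ^+ 2.
  rewrite /E bopD bopZ normD_reinner phiD phiZ reinnerZr normrZ exprMn.
  by rewrite real_normK ?num_real//; ring.
pose approx e u := forall v, `|reinner (T u) (T v) - phi v| <= e * `|T v|.
have approx_ex e : 0 < e -> exists u, approx e u.
  move=> e0; have e20 : 0 < e ^+ 2 by rewrite exprn_gt0.
  have [_ [u _ <-] uE] := inf_adherent e20 Einf; exists u => v.
  set b := _ - _.
  have key t : 0 <= e ^+ 2 + 2 * t * b + t ^+ 2 * `|T v| ^+ 2.
    have : inf (range E) <= E (u + t *: v).
      by apply: ge_inf; [exact: Einf.2 | exists (u + t *: v)].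
    by rewrite ET -/b; lra.
  (* The parabola [key] is nonnegative; its vertex bounds [b]. *)
  have [Tv0|Tvn0] := eqVneq (T v) 0.
    have v0 : v = 0.
      apply/eqP; rewrite -normr_le0 -(pmulr_rle0 _ a0) (le_trans (Ta v))//.
      by rewrite Tv0 normr0.
    have phi0 : phi 0 = 0 by rewrite -(scale0r (0 : U)) phiZ mul0r.
    by rewrite /b v0 bop0 phi0 /reinner inner0r subrr !normr0 mulr0.
  have n0 : 0 < `|T v| by rewrite normr_gt0.
  rewrite -(ler_pXn2r (n := 2)) ?nnegrE ?mulr_ge0 ?(ltW e0)//.
  rewrite real_normK ?num_real// exprMn -subr_ge0.
  have := key (- b / `|T v| ^+ 2).
  rewrite (_ : e ^+ 2 + _ + _ = (e ^+ 2 * `|T v| ^+ 2 - b ^+ 2) / `|T v| ^+ 2).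
    by rewrite pmulr_lge0// invr_gt0 exprn_gt0.
  by field; rewrite gt_eqF.
have approx_near e e' u u' : 0 <= e -> 0 <= e' -> approx e u -> approx e' u' ->
    a * `|u - u'| <= e + e'.
  move=> e0 e'0 eu e'u'; rewrite (le_trans (Ta _))//.
  set z := u - u'; have [->|Tz0] := eqVneq (T z) 0.
    by rewrite normr0 addr_ge0.
  have n0 : 0 < `|T z| by rewrite normr_gt0.
  have zE : T z = T u - T u' by rewrite bopB.
  rewrite -(ler_pM2r n0) -expr2 -reinner_norm.
  rewrite {1}zE reinnerDl reinnerNl mulrDl.
  have /ler_normlP[? ?] := eu z; have /ler_normlP[? ?] := e'u' z.
  by lra.
have s0 n : 0 < n.+1%:R^-1 :> R by rewrite invr_gt0.
have [u uP] := choice (fun n => approx_ex _ (s0 n)).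
have dist_u n m : `|u n - u m| <= a^-1 * (n.+1%:R^-1 + m.+1%:R^-1).
  by rewrite ler_pdivlMl// approx_near ?(ltW (s0 _)).
have /cauchy_cvgP/cvg_ex[w uw] : cauchy (u @ \oo).
  apply: cauchy_exP => e e0.
  have ae : 0 < a * e / 2 by rewrite divr_gt0 ?mulr_gt0.
  have [N _ NP] := near_infty_natSinv_lt (PosNum ae).
  exists (u N); exists N => // n /= Nn; rewrite -ball_normE /=.
  rewrite (le_lt_trans (dist_u _ _))// ltr_pdivrMl//.
  rewrite (splitr (a * e)) ltrD//; [exact: (NP N (leqnn N))|exact: (NP n Nn)].
exists w => v; apply/eqP; rewrite -subr_eq0 -normr_le0.
apply/ler_addgt0Pr => e e0; rewrite add0r.
pose k := opnorm T * `|T v| + `|T v| + 1.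
have k0 : 0 < k by rewrite ltr_wpDl// addr_ge0 ?mulr_ge0 ?opnorm_ge0.
have ek : 0 < e / k by rewrite divr_gt0.
have [N1 _ N1P] := (cvgrPdist_le _ _).1 uw _ ek.
have [N2 _ N2P] := near_infty_natSinv_lt (PosNum ek).
have := N1P (maxn N1 N2) (leq_maxl _ _).
have := N2P (maxn N1 N2) (leq_maxr _ _).
rewrite /=; set n := maxn N1 N2 => nk uk.
rewrite (_ : _ - _ = reinner (T (w - u n)) (T v) +
    (reinner (T (u n)) (T v) - phi v)); last first.
  by rewrite bopB reinnerDl reinnerNl; ring.
rewrite (le_trans (ler_normD _ _))// (_ : e = e / k * k); last first.
  by rewrite divfK// gt_eqF.
rewrite {2}/k !mulrDr mulr1 -[leLHS]addr0 lerD ?(ltW ek)// lerD//.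
  rewrite (le_trans (reinner_le _ _))// mulrA ler_wpM2r//.
  by rewrite (le_trans (opnormP _ _))// mulrC ler_wpM2r ?opnorm_ge0.
by rewrite (le_trans (uP n v))// ler_wpM2r// ltW.
Qed.

(** An additive right homogeneous functional is determined by its real part,
    which the real Riesz theorem represents. *)
Lemma riesz U V (T : bop U V) v :
  exists w, forall u, inner (T u) v = inner u w.
Proof.
have [w wP] : exists w, forall u, reinner w u = reinner (T u) v.
  apply: (@energy_solution U U (bop_id U) (fun u => reinner (T u) v) 1
    (opnorm T * `|v|)) => //= [u|u u'|x u|u].
  - by rewrite mul1r.
  - by rewrite bopD reinnerDl.
  - by rewrite bopZ reinnerZl.
  - by rewrite (le_trans (reinner_le _ _))// mulrAC ler_wpM2r// opnormP.
exists w => u.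
have E a : qre (inner (T u) v * a) = qre (inner u w * a).
  by rewrite -!inner_qrmull -bop_qrmul -!/(reinner _ _) -wP reinnerC.
have := E 1; have := E (Quat 0 1 0 0); have := E (Quat 0 0 1 0).
have := E (Quat 0 0 0 1).
by move=> /= E1 E2 E3 E4; apply: quatP; lra.
Qed.

Lemma adjointP U V (T : bop U V) u v : inner (T u) v = inner u (adjoint T v).
Proof.
suff : [set S : bop V U | forall u v, inner (T u) v = inner u (S v)] !=set0.
  by move=> /getPex /=; apply.
have [S SP] := choice (riesz T).
have SD v1 v2 : S (v1 + v2) = S v1 + S v2.
  by apply: inner_eqr => w; rewrite innerDr -!SP innerDr.
have Sq v1 b : S (qrmul v1 b) = qrmul (S v1) b.
  by apply: inner_eqr => w; rewrite inner_qrmulr -!SP inner_qrmulr.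
have Sb : exists c : R, forall v1, `|S v1| <= c * `|v1|.
  exists (opnorm T) => v1; have [->|n0] := eqVneq (S v1) 0.
    by rewrite normr0 mulr_ge0 ?opnorm_ge0.
  have n1 : 0 < `|S v1| by rewrite normr_gt0.
  rewrite -(ler_pM2r n1) -expr2 -reinner_norm /reinner -SP -/(reinner _ _).
  rewrite (le_trans (ler_norm _))// (le_trans (reinner_le _ _))//.
  by rewrite mulrAC ler_wpM2r// opnormP.
by exists (Bop SD Sq Sb) => u1 v1 /=.
Qed.

Lemma adjoint_uniq U V (T : bop U V) (S : bop V U) :
  (forall u v, inner (T u) v = inner u (S v)) -> adjoint T = S.
Proof.
by move=> TS; apply: bopP => v; apply: inner_eqr => u; rewrite -adjointP TS.
Qed.

Lemma adjointPr U V (T : bop U V) u v : inner (adjoint T v) u = inner v (T u).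
Proof. by rewrite inner_conj -adjointP -inner_conj. Qed.

Lemma reinner_bop_re U (T : bop U U) u :
  reinner (bop_re T u) u = reinner (T u) u.
Proof.
rewrite [bop_re T u]/(2^-1 *: (T u + adjoint T u)) reinnerZl reinnerDl.
rewrite [reinner (adjoint T u) u]/reinner adjointPr -/(reinner _ _).
by rewrite [reinner u _]reinnerC; field.
Qed.

Lemma adjointK U V (T : bop U V) : adjoint (adjoint T) = T.
Proof. by apply: adjoint_uniq => v u; rewrite adjointPr. Qed.

Lemma adjointD U V (S T : bop U V) : adjoint (S + T) = adjoint S + adjoint T.
Proof.
by apply: adjoint_uniq => u v; rewrite innerDl innerDr !adjointP.
Qed.

Lemma adjoint_comp U V W (S : bop V W) (T : bop U V) :
  adjoint (S *o T) = adjoint T *o adjoint S.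
Proof. by apply: adjoint_uniq => u v /=; rewrite !adjointP. Qed.

Lemma adjoint_qlmul (H : twoSidedQHilbertType R) (a : quat R) :
  adjoint (qlmul_bop H a) = qlmul_bop H (qconj a).
Proof. by apply: adjoint_uniq => u v /=; rewrite inner_qlmul. Qed.

Lemma bop_inverse_exists U (T : bop U U) (a : R) : 0 < a ->
  (forall u, a * `|u| <= `|T u|) -> (forall f, exists u, T u = f) ->
  exists S, bop_inverse S T.
Proof.
move=> a0 Ta Tsurj; have [S SP] := choice Tsurj.
have Tinj u v : T u = T v -> u = v.
  move=> uv; apply/eqP; rewrite -subr_eq0 -normr_le0 -(pmulr_rle0 _ a0).
  by rewrite (le_trans (Ta _))// bopD -scaleN1r bopZ uv scaleN1r subrr normr0.
have SD v1 v2 : S (v1 + v2) = S v1 + S v2 by apply: Tinj; rewrite bopD !SP.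
have Sq v1 b : S (qrmul v1 b) = qrmul (S v1) b.
  by apply: Tinj; rewrite bop_qrmul !SP.
have Sb : exists c : R, forall v1, `|S v1| <= c * `|v1|.
  by exists a^-1 => v1; rewrite ler_pdivlMl// -{2}(SP v1).
exists (Bop SD Sq Sb); split; apply: bopP => u /=; last exact: SP.
by apply: Tinj; rewrite SP.
Qed.

(** Lax--Milgram.  The residual [T u - f] of the least squares solution [u] is
    orthogonal to the range of [T], in particular to its own image. *)
Lemma coercive_inverse U (T : bop U U) (a : R) : 0 < a ->
  (forall u, a * `|u| ^+ 2 <= reinner (T u) u) -> exists S, bop_inverse S T.
Proof.
move=> a0 Tcoer.
have Ta u : a * `|u| <= `|T u|.
  have [->|u0] := eqVneq u 0; first by rewrite normr0 mulr0.
  have n0 : 0 < `|u| by rewrite normr_gt0.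
  rewrite -(ler_pM2r n0) -mulrA -expr2 (le_trans (Tcoer u))//.
  by rewrite (le_trans (ler_norm _))// reinner_le.
apply: (bop_inverse_exists a0) => // f.
have [u uP] : exists u, forall v, reinner (T u) (T v) = reinner f (T v).
  apply: (@energy_solution U U T (fun v => reinner f (T v)) a
    (`|f| * opnorm T)) => //= [u v|x u|u].
  - by rewrite bopD reinnerDr.
  - by rewrite bopZ reinnerZr.
  - by rewrite (le_trans (reinner_le _ _))// -mulrA ler_wpM2l// opnormP.
exists u; apply/eqP; rewrite -subr_eq0; set z := _ - _.
have z0 : reinner (T z) z = 0.
  by rewrite reinnerC /z reinnerDl reinnerNl uP subrr.
have := Tcoer z; rewrite z0 pmulr_rle0// => z1.
by rewrite -normr_eq0 -sqrf_eq0 eq_le z1 sqr_ge0.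
Qed.

(** The operator is [(1 - p A) (1 - conj(p) A)], but [p] does not act on [U].
    With [W = Re(p) - |p|^2 A], multiplying it by [|p|^2] gives
    [W^2 + |Im p|^2 = W (W + |Im p|^2 W^-1)], and both factors are coercive. *)
Lemma dissipative_inverse_exists U (A : bop U U) (p : quat R) :
  (forall u, reinner (A u) u <= 0) -> 0 < qre p ->
  exists S, bop_inverse S
    (bop_id U - (2 * qre p) *: A + (`|p| ^+ 2) *: (A *o A)).
Proof.
move=> Adiss x0; set x := qre p; set s := `|p| ^+ 2.
have b0 : 0 <= s - x ^+ 2 by rewrite subr_ge0 sqr_qre_le.
have s0 : 0 < s by rewrite (lt_le_trans _ (sqr_qre_le p))// exprn_gt0.
pose W := x *: bop_id U - s *: A.
have Wcoer u : x * `|u| ^+ 2 <= reinner (W u) u.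
  rewrite /= reinnerDl reinnerNl !reinnerZl reinner_norm lerDl oppr_ge0.
  by rewrite pmulr_rle0.
have [V [VW WV]] := coercive_inverse x0 Wcoer.
have WVe u : W (V u) = u by rewrite -[RHS]/(bop_id U u) -WV.
have VWe u : V (W u) = u by rewrite -[RHS]/(bop_id U u) -VW.
pose Y := W + (s - x ^+ 2) *: V.
have Ycoer u : x * `|u| ^+ 2 <= reinner (Y u) u.
  rewrite [Y u]/(W u + (s - x ^+ 2) *: V u) reinnerDl reinnerZl -[leLHS]addr0.
  rewrite lerD ?Wcoer// mulr_ge0// -{2}(WVe u) reinnerC.
  by rewrite (le_trans _ (Wcoer _))// mulr_ge0 ?sqr_ge0// ltW.
have [Z [ZY YZ]] := coercive_inverse x0 Ycoer.
have YZe u : Y (Z u) = u by rewrite -[RHS]/(bop_id U u) -YZ.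
have ZYe u : Z (Y u) = u by rewrite -[RHS]/(bop_id U u) -ZY.
set T := _ + _.
have TE u : s *: T u = W (Y u).
  rewrite [W (Y u)]bopD [W (_ *: _)]bopZ WVe /= !bopB !bopZ.
  by vector_field.
exists (s *: (Z *o V)); split; apply: bopP => u /=.
  by rewrite -2!bopZ TE VWe ZYe.
have s_neq0 : s != 0 by rewrite gt_eqF.
by apply: (scalerI s_neq0); rewrite TE !bopZ YZe WVe.
Qed.

End Adjoint.

(** * Star products and the Lyapunov equation of the kernel *)

Section Star.
Variables (R : realType) (H : twoSidedQHilbertType R).
Implicit Types (p q a : quat R) (f g h : quat R -> bop H H) (T X : bop H H).

Lemma qlmulZr a x (u : H) : qlmul a (x *: u) = x *: qlmul a u.
Proof. exact: (bopZ (qlmul_bop H a)). Qed.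

Lemma qlmulNr a (u : H) : qlmul a (- u) = - qlmul a u.
Proof. exact: (bopN (qlmul_bop H a)). Qed.

Lemma qlmulZl a x (u : H) : qlmul (x *: a) u = x *: qlmul a u.
Proof. by rewrite -qlmul_real qlmulA -scalerAl mul1r. Qed.

Lemma qlmulNl a (u : H) : qlmul (- a) u = - qlmul a u.
Proof. by rewrite -scaleN1r qlmulZl scaleN1r. Qed.

Lemma qlmul1 (u : H) : qlmul 1 u = u.
Proof. by rewrite -[1]scale1r qlmul_real scale1r. Qed.

Lemma reinner_qlmul a (u v : H) :
  reinner (qlmul a u) v = reinner u (qlmul (qconj a) v).
Proof. by rewrite /reinner inner_qlmul. Qed.

Lemma imag_unit_sqr p : imag_unit p * imag_unit p = -1.
Proof.
rewrite /imag_unit; case: eqP => [_|/eqP n0].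
  by apply: quatP => /=; ring.
have : `|qim p| ^+ 2 != 0 by rewrite sqrf_eq0 normr_eq0.
rewrite -scalerAl -scalerAr scalerA -invfM -expr2.
rewrite sqr_normq => n2; rewrite -[RHS]scale1r -(mulVf n2) -scalerA.
by congr (_ *: _); apply: quatP; rewrite /qnorm2 /=; ring.
Qed.

Lemma imag_unit_decomp p : p = (qre p)%:A + `|qim p| *: imag_unit p.
Proof.
transitivity ((qre p)%:A + qim p); first by apply: quatP => /=; ring.
congr (_ + _); rewrite /imag_unit; case: eqP => [->|/eqP n0].
  by rewrite normr0 scale0r.
by rewrite scalerA divff ?scale1r// normr_eq0.
Qed.

Lemma qconj_imag_unit p : qconj (imag_unit p) = - imag_unit p.
Proof.
by rewrite /imag_unit; case: eqP => _; apply: quatP => /=; ring.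
Qed.

Lemma qlmul_decomp p (u : H) :
  qlmul p u = qre p *: u + `|qim p| *: qlmul (imag_unit p) u.
Proof.
by rewrite {1}[p]imag_unit_decomp qlmulDl qlmul_real qlmulZl.
Qed.

Lemma qlmul_conj_decomp p (u : H) :
  qlmul (qconj p) u = qre p *: u - `|qim p| *: qlmul (imag_unit p) u.
Proof.
have -> : qconj p = (qre p)%:A - `|qim p| *: imag_unit p.
  rewrite {1}[p]imag_unit_decomp -scalerN -qconj_imag_unit.
  by apply: quatP => /=; ring.
by rewrite qlmulDl qlmul_real qlmulNl qlmulZl.
Qed.

Lemma qlmul_imag_unit p (u : H) :
  qlmul (imag_unit p) (qlmul (imag_unit p) u) = - u.
Proof. by rewrite qlmulA imag_unit_sqr qlmulNl qlmul1. Qed.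

(** Every value is expanded into real combinations of words in the imaginary
    unit and the values of the functions at the two conjugate points. *)
Let starE := (qconjK, qlmulNl, @qlmulDr R H, qlmulNr, qlmulZr, bopD, bopN, bopZ,
  qlmul_imag_unit, @opprK H).

Lemma lstar_id f p : lstar f (fun=> bop_id H) p = f p.
Proof.
apply: bopP => u; rewrite /lstar /lslice0 /lslice1 /= !starE.
by vector_field.
Qed.

Lemma lstarDr f g h p :
  lstar f (fun a => g a + h a) p = lstar f g p + lstar f h p.
Proof.
apply: bopP => u; rewrite /lstar /lslice0 /lslice1 /= !starE.
by vector_field.
Qed.

Lemma lstar_compr f g T p :
  lstar f (fun a => g a *o T) p = lstar f g p *o T.
Proof. by apply: bopP => u. Qed.

(** The variable has real components along [1] and [imag_unit p], so it
    commutes with the star product. *)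
Lemma lstar_qlmul f g p :
  lstar f (fun a => qlmul_bop H a *o g a) p = qlmul_bop H p *o lstar f g p.
Proof.
apply: bopP => u; rewrite /lstar /lslice0 /lslice1 /=.
rewrite !(qlmul_decomp p) !qlmul_conj_decomp !starE.
by vector_field.
Qed.

Lemma rstar_id f q : rstar (fun=> bop_id H) f q = f q.
Proof.
apply: bopP => u.
rewrite /rstar /rslice0 /rslice1 /= qconj_imag_unit !starE.
by vector_field.
Qed.

Lemma rstarDl f g h q :
  rstar (fun a => f a + g a) h q = rstar f h q + rstar g h q.
Proof.
apply: bopP => u; rewrite /rstar /rslice0 /rslice1 /= !starE.
by vector_field.
Qed.

Lemma rstar_compl f g T q :
  rstar (fun a => T *o f a) g q = T *o rstar f g q.
Proof.
apply: bopP => u; rewrite /rstar /rslice0 /rslice1 /= !starE.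
by vector_field.
Qed.

Lemma rstar_qlmul f g q :
  rstar (fun a => f a *o qlmul_bop H (qconj a)) g q =
  rstar f g q *o qlmul_bop H (qconj q).
Proof.
apply: bopP => u; rewrite /rstar /rslice0 /rslice1 /= qconj_imag_unit !starE.
rewrite !(qlmul_decomp q) !qlmul_conj_decomp !starE.
by vector_field.
Qed.
End Star.

Section Lyapunov.
Variables (R : realType) (H : twoSidedQHilbertType R).
Implicit Types (p q a : quat R) (X : bop H H) (Phi : quat R -> bop H H).

(** On real points [khalf] is [1 / (x + y)]; this is the slice hyperholomorphic
    extension of [x k + k y = 1]. *)
Lemma khalf_eq p q : 0 < qre p -> 0 < qre q ->
  p * khalf p q + khalf p q * qconj q = 1.
Proof.
move=> p0 q0; rewrite /khalf; set d := _ + _ + _.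
have d0 : d != 0 by apply: companion_neq0.
have dq : d^-1 * qconj q = qconj q * d^-1.
  by apply/esym/GRing.commrV; rewrite /GRing.comm /d; apply: quatP => /=; ring.
rewrite -mulrA dq !mulrA -mulrDl.
suff -> : p * (qconj p + qconj q) + (qconj p + qconj q) * qconj q = d.
  exact: qmulV.
by rewrite /d sqr_normq /qnorm2; apply: quatP => /=; ring.
Qed.

Lemma lstar_eq f g h p :
  g p = h p -> g (qconj p) = h (qconj p) ->
  lstar f g p = lstar f h p :> bop H H.
Proof. by rewrite /lstar /lslice0 /lslice1 => -> ->. Qed.

Lemma rstar_eq f g h q :
  f q = g q -> f (qconj q) = g (qconj q) ->
  rstar f h q = rstar g h q :> bop H H.
Proof. by rewrite /rstar /rslice0 /rslice1 => -> ->. Qed.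

Lemma khalf_bop_eq p q : 0 < qre p -> 0 < qre q ->
  qlmul_bop H p *o qlmul_bop H (khalf p q) +
  qlmul_bop H (khalf p q) *o qlmul_bop H (qconj q) = bop_id H.
Proof.
move=> p0 q0; apply: bopP => u /=.
by rewrite !qlmulA -qlmulDl khalf_eq// qlmul1.
Qed.

(** Multiplication by [p] on the left and by [qconj q] on the right passes
    through the star products and reaches [khalf], so that the denominators
    disappear. *)
Lemma kernel_Phi_sylvester Phi p q : 0 < qre p -> 0 < qre q ->
  qlmul_bop H p *o kernel_Phi Phi p q +
  kernel_Phi Phi p q *o qlmul_bop H (qconj q) = Phi p + adjoint (Phi q).
Proof.
move=> p0 q0; rewrite /kernel_Phi.
set k1 := fun a => _; set k2 := fun a => qlmul_bop H (khalf p a).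
set f2 := fun a => adjoint _.
have left_part : qlmul_bop H p *o lstar Phi k1 p +
    lstar Phi k1 p *o qlmul_bop H (qconj q) = Phi p.
  rewrite -lstar_qlmul -lstar_compr -lstarDr -[RHS]lstar_id.
  by apply: lstar_eq; apply: khalf_bop_eq.
have right_part : qlmul_bop H p *o rstar k2 f2 q +
    rstar k2 f2 q *o qlmul_bop H (qconj q) = f2 q.
  rewrite -rstar_compl -rstar_qlmul -rstarDl -[RHS]rstar_id.
  by apply: rstar_eq; apply: khalf_bop_eq.
rewrite -[adjoint _]/(f2 q) -left_part -right_part.
apply: bopP => u /=; rewrite qlmulDr; by vector_field.
Qed.

(** The real quadratic polynomial annihilating [qconj q] kills [X] on the right;
    moved to the left with [X conj(q) = - p X], it becomes an invertible
    quaternion. *)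
Lemma sylvester_inj p q X : 0 < qre p -> 0 < qre q ->
  qlmul_bop H p *o X + X *o qlmul_bop H (qconj q) = 0 -> X = 0.
Proof.
move=> p0 q0 E.
have Xq u : X (qlmul (qconj q) u) = - qlmul p (X u).
  have := congr1 (fun T : bop H H => T u) E.
  by move/eqP; rewrite /= addrC addr_eq0 => /eqP.
set d := (`|q| ^+ 2)%:A + (2 * qre q) *: p + p ^+ 2.
have d0 : d != 0 by apply: companion_neq0.
apply: bopP => u; rewrite -[LHS]qlmul1 -(qmulVl d0) -qlmulA.
suff -> : qlmul d (X u) = 0 by rewrite -(scale0r 0) qlmulZr scale0r.
have q2 : qconj q * qconj q = (2 * qre q) *: qconj q - (`|q| ^+ 2)%:A.
  by rewrite sqr_normq /qnorm2; apply: quatP => /=; ring.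
have XE : (2 * qre q) *: - qlmul p (X u) - (`|q| ^+ 2) *: X u =
    qlmul p (qlmul p (X u)).
  rewrite -[RHS]opprK -[in RHS]qlmulNr -!Xq.
  by rewrite qlmulA q2 qlmulDl qlmulZl qlmulNl qlmul_real bopB !bopZ.
rewrite /d !qlmulDl qlmul_real qlmulZl expr2 -qlmulA -XE.
by vector_field.
Qed.

Lemma kernel_Phi_adjoint Phi p q : 0 < qre p -> 0 < qre q ->
  adjoint (kernel_Phi Phi p q) = kernel_Phi Phi q p.
Proof.
move=> p0 q0.
have := kernel_Phi_sylvester Phi p0 q0; have := kernel_Phi_sylvester Phi q0 p0.
move: (kernel_Phi Phi p q) (kernel_Phi Phi q p) => K K' EK' EK.
have E : qlmul_bop H q *o adjoint K + adjoint K *o qlmul_bop H (qconj p) =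
    qlmul_bop H q *o K' + K' *o qlmul_bop H (qconj p).
  have := congr1 (@adjoint _ _ _) EK.
  rewrite !adjointD !adjoint_comp !adjoint_qlmul qconjK adjointK => EKa.
  by rewrite EK' addrC EKa addrC.
apply/eqP; rewrite -subr_eq0; apply/eqP.
apply: (sylvester_inj (p := q) (q := p)) => //; apply: bopP => u.
have Eu : qlmul q (adjoint K u) + adjoint K (qlmul (qconj p) u) =
    qlmul q (K' u) + K' (qlmul (qconj p) u).
  exact: (congr1 (fun T : bop H H => T u) E).
change (qlmul q (adjoint K u - K' u) +
  (adjoint K (qlmul (qconj p) u) - K' (qlmul (qconj p) u)) = 0).
by rewrite qlmulDr qlmulNr addrACA Eu -opprD subrr.
Qed.

(** With [z] the Cayley transform of [qconj p], the hypothesis says that the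
    form does not increase under [c |-> z c]; as [|z| < 1], the iterates of [c]
    tend to [0]. *)
Lemma lyapunov_ge0 N (p : 'I_N -> quat R) (X : 'I_N -> 'I_N -> bop H H) :
  (forall i, 0 < qre (p i)) ->
  (forall c : 'I_N -> H, 0 <= \sum_i \sum_j reinner
     ((qlmul_bop H (p i) *o X i j + X i j *o qlmul_bop H (qconj (p j))) (c j))
     (c i)) ->
  forall c : 'I_N -> H, 0 <= \sum_i \sum_j reinner (X i j (c j)) (c i).
Proof.
move=> p0 XR c.
pose z i := (1 - qconj (p i)) * (1 + qconj (p i))^-1.
pose form d := \sum_i \sum_j reinner (X i j (d j)) (d i).
have form_step (d : 'I_N -> H) : form (fun i => qlmul (z i) (d i)) <= form d.
  (* In terms of [e], [d] and [z d] are [(1 + conj(p)) e] and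
     [(1 - conj(p)) e], so that the difference of the two forms is polarised
     into twice the form of the hypothesis. *)
  pose e i := qlmul (1 + qconj (p i))^-1 (d i).
  have dE i : d i = e i + qlmul (qconj (p i)) (e i).
    rewrite -{1}[e i]qlmul1 -qlmulDl qlmulA qmulV ?qlmul1//.
    by rewrite qre_gt0_neq0//= addr_gt0.
  have zE i : qlmul (z i) (d i) = e i - qlmul (qconj (p i)) (e i).
    by rewrite -{1}[e i]qlmul1 -qlmulNl -qlmulDl qlmulA.
  rewrite -subr_ge0 /form -sumrB.
  under eq_bigr do rewrite -sumrB.
  rewrite [X in 0 <= X](_ : _ = 2 * \sum_i \sum_j reinner
    ((qlmul_bop H (p i) *o X i j + X i j *o qlmul_bop H (qconj (p j))) (e j))
    (e i)); first by rewrite mulr_ge0.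
  rewrite mulr_sumr; apply: eq_bigr => i _; rewrite mulr_sumr.
  apply: eq_bigr => j _; rewrite !zE (dE i) (dE j) bopB bopD /=.
  rewrite !(reinnerDl, reinnerDr, reinnerNl, reinnerNr).
  by rewrite reinner_qlmul; ring.
pose orb n i := qlmul (z i ^+ n) (c i).
have form_orb n : form (orb n) <= form c.
  elim: n => [|n IHn].
    rewrite (_ : orb 0%N = c)//.
    by apply/funext => i; rewrite /orb expr0 qlmul1.
  rewrite (_ : orb n.+1 = fun i => qlmul (z i) (orb n i)); last first.
    by apply/funext => i; rewrite /orb exprS -qlmulA.
  exact: le_trans (form_step _) IHn.
pose r := \big[Order.max/0]_i `|z i|.
have r1 : r < 1.
  by apply: bigmax_lt => // i _; apply: cayley_lt1; apply: p0.
have zr i : `|z i| <= r by apply: le_bigmax.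
have r0 : 0 <= r by apply: bigmax_ge_id.
have orb_le n i : `|orb n i| <= r ^+ n * `|c i|.
  rewrite /orb; elim: n => [|n IHn]; first by rewrite !expr0 qlmul1 mul1r.
  by rewrite !exprS -qlmulA qlmul_norm -mulrA ler_pM.
pose M := \sum_i \sum_j `|X i j| * `|c j| * `|c i|.
have form_ge n : - (M * r ^+ n) <= form (orb n).
  rewrite /form mulr_suml -sumrN ler_sum// => i _.
  rewrite mulr_suml -sumrN ler_sum// => j _.
  suff : `|reinner (X i j (orb n j)) (orb n i)| <=
      `|X i j| * `|c j| * `|c i| * r ^+ n by rewrite ler_norml => /andP[].
  rewrite (le_trans (reinner_le _ _))//.
  have h : `|X i j (orb n j)| <= `|X i j| * `|c j|.
    rewrite (le_trans (opnormP _ _))// ler_wpM2l ?opnorm_ge0//.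
    by rewrite (le_trans (orb_le _ _))// ler_piMl// exprn_ile1// ltW.
  by rewrite mulrAC -[leRHS]mulrA ler_pM// mulrC.
have M0 : M * r ^+ n @[n --> \oo] --> (0 : R).
  by apply: cvg_geometric; rewrite ger0_norm.
have : - form c <= limn (fun n => M * r ^+ n).
  apply: limr_ge; first by apply/cvg_ex; exists 0.
  by near=> n; rewrite lerNl (le_trans (form_ge n)).
by rewrite (cvg_lim _ M0)// oppr_le0.
Unshelve. all: by end_near. Qed.

End Lyapunov.

(** * Realizations with dissipative block operator *)

Section Realization.
Variables (R : realType) (H : twoSidedQHilbertType R).
Variables (H1 : rightQHilbertType R).
Variables (A : bop H1 H1) (B : bop H H1) (C : bop H1 H) (D : bop H H).
Implicit Types (p q : quat R) (S : bop H1 H1) (Phi : quat R -> bop H H).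

Local Notation M := (bop_block A B C D).
Local Notation J := (bop_block (bop_id H1) 0 0 (- bop_id H)).

Hypothesis MJ_le0 : bop_le0 (bop_re (M *o J)).

Lemma block_dissipative w : reinner (J w) (adjoint M w) <= 0.
Proof.
have [] := MJ_le0 w.
rewrite qreN -/(reinner _ _) reinner_bop_re oppr_ge0 => h _.
by rewrite /reinner -adjointP.
Qed.

Lemma state_dissipative (u : H1) : reinner (A u) u <= 0.
Proof.
have := block_dissipative (HSum u 0); rewrite /reinner -adjointP.
by rewrite inner_hsum /= subr0 !bop0 !addr0 inner0r addr0.
Qed.

(** The extension of [C (I - x A)^-1] off the real axis. *)
Definition star_resolvent p S : bop H1 H :=
  (C - qlmul_bop H (qconj p) *o C *o A) *o S.

Definition pencil_inverse p S := bop_inverse S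
  (bop_id H1 - (2 * qre p) *: A + (`|p| ^+ 2) *: (A *o A)).

(** [C (I - x A)^-1 (I - x A) = C], extended off the real axis. *)
Lemma star_resolventP p S u : pencil_inverse p S ->
  star_resolvent p S u - qlmul p (star_resolvent p S (A u)) = C u.
Proof.
case=> ST TS; set T := _ + _ in ST TS.
have STe v : S (T v) = v := congr1 (fun X : bop H1 H1 => X v) ST.
have TSe v : T (S v) = v := congr1 (fun X : bop H1 H1 => X v) TS.
have TA v : T (A v) = A (T v).
  by rewrite /= !bopD bopN !bopZ.
have SA v : S (A v) = A (S v) by rewrite -{1}(TSe v) -TA STe.
rewrite /star_resolvent /= SA; set z := S u.
rewrite -[in RHS](TSe u) -/z /= qlmulDr qlmulNr qlmulA.
have -> : p * qconj p = (`|p| ^+ 2)%:A.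
  by rewrite sqr_normq /qnorm2; apply: quatP => /=; ring.
rewrite qlmul_real !bopD bopN !bopZ qlmul_conj_decomp (qlmul_decomp p).
by vector_field.
Qed.

Variables (Omega : set (quat R)) (Phi : quat R -> bop H H).
Hypothesis PhiE : realization Omega Phi A B C D.

Lemma realizationP p S v : Omega p -> pencil_inverse p S ->
  Phi p v = D v + qlmul p (star_resolvent p S (B v)).
Proof. by move=> Op pS; rewrite (PhiE Op pS). Qed.

(** With [g := F^* d], the colligation identity
    [M^* (x g, d) = (g, Phi(x)^* d)], extended off the real axis. *)
Lemma adjoint_block p S (d : H) : Omega p -> pencil_inverse p S ->
  adjoint M (HSum (adjoint (star_resolvent p S) (qlmul (qconj p) d)) d) =
  HSum (adjoint (star_resolvent p S) d) (adjoint (Phi p) d).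
Proof.
move=> Op pS; apply: inner_eqr => -[u v]; rewrite -adjointP.
rewrite !inner_hsum /=; set F := star_resolvent p S.
rewrite -!adjointP (realizationP _ Op pS) -inner_qlmul.
rewrite -(star_resolventP u pS) -/F -!innerDl bopD qlmulDr.
by congr (inner _ _); vector_field.
Qed.

Lemma pencil_inverse_exists p : 0 < qre p -> exists S, pencil_inverse p S.
Proof. exact: dissipative_inverse_exists state_dissipative. Qed.

(** The kernel is [F(p) F(q)^*] plus the solution [X] of a Lyapunov equation
    whose right-hand side is the negative of the colligation form. *)
Lemma kernel_Phi_ge0 N (w : 'I_N -> quat R) (c : 'I_N -> H) :
  (forall i, Omega (w i) /\ 0 < qre (w i)) ->
  0 <= \sum_i \sum_j reinner (kernel_Phi Phi (w i) (w j) (c j)) (c i).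
Proof.
move=> wE; have w0 i : 0 < qre (w i) by case: (wE i).
have [S SP] := choice (fun i => pencil_inverse_exists (w0 i)).
pose F i := star_resolvent (w i) (S i).
pose X i j := kernel_Phi Phi (w i) (w j) - F i *o adjoint (F j).
have FF (d : 'I_N -> H) :
    \sum_i \sum_j reinner (F i (adjoint (F j) (d j))) (d i) =
    `|\sum_j adjoint (F j) (d j)| ^+ 2.
  rewrite -reinner_norm reinner_sum; apply: eq_bigr => i _.
  by apply: eq_bigr => j _; rewrite /reinner adjointP.
have -> : \sum_i \sum_j reinner (kernel_Phi Phi (w i) (w j) (c j)) (c i) =
    \sum_i \sum_j reinner (X i j (c j)) (c i) +
    \sum_i \sum_j reinner (F i (adjoint (F j) (c j))) (c i).
  rewrite -big_split; apply: eq_bigr => i _; rewrite -big_split.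
  apply: eq_bigr => j _.
  by rewrite /= -reinnerDl subrK.
rewrite FF addr_ge0 ?sqr_ge0//; apply: (lyapunov_ge0 w0) => d.
pose v i : hsum H1 H :=
  HSum (adjoint (F i) (qlmul (qconj (w i)) (d i))) (d i).
have vE i : adjoint M (v i) =
    HSum (adjoint (F i) (d i)) (adjoint (Phi (w i)) (d i)).
  by apply: adjoint_block; [exact: (wE i).1 | exact: SP].
(* The Sylvester equation for [kernel_Phi] replaces the star products by
   [Phi(p) + Phi(q)^*], whose remaining terms match the colligation form. *)
have term i j : reinner ((qlmul_bop H (w i) *o X i j +
    X i j *o qlmul_bop H (qconj (w j))) (d j)) (d i) =
    - (reinner (J (v j)) (adjoint M (v i)) +
       reinner (adjoint M (v j)) (J (v i))).
  have K : qlmul (w i) (kernel_Phi Phi (w i) (w j) (d j)) +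
      kernel_Phi Phi (w i) (w j) (qlmul (qconj (w j)) (d j)) =
      Phi (w i) (d j) + adjoint (Phi (w j)) (d j) :=
    congr1 (fun T : bop H H => T (d j)) (kernel_Phi_sylvester Phi (w0 i) (w0 j)).
  transitivity (reinner (Phi (w i) (d j) + adjoint (Phi (w j)) (d j)) (d i) -
    reinner (qlmul (w i) (F i (adjoint (F j) (d j)))) (d i) -
    reinner (F i (adjoint (F j) (qlmul (qconj (w j)) (d j)))) (d i)).
    rewrite -K -!reinnerNl -!reinnerDl; congr reinner.
    have split_sum (a b e f : H) : qlmul (w i) (a - b) + (e - f) =
        qlmul (w i) a + e - qlmul (w i) b - f.
      by rewrite qlmulDr qlmulNr addrACA addrA.
    exact: split_sum.
  rewrite !vE /reinner !inner_hsum /= !add0r !addr0 inner_qlmul innerDl.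
  rewrite !innerNl !innerNr (adjointP (Phi _)) !(adjointP (F i)) !qreD !qreN.
  by ring.
have sumJM : \sum_i \sum_j reinner (J (v j)) (adjoint M (v i)) =
    reinner (J (\sum_i v i)) (adjoint M (\sum_i v i)).
  by rewrite !bop_sum reinner_sum.
have sumMJ : \sum_i \sum_j reinner (adjoint M (v j)) (J (v i)) =
    reinner (J (\sum_i v i)) (adjoint M (\sum_i v i)).
  by rewrite reinnerC !bop_sum reinner_sum.
have -> : \sum_i \sum_j reinner ((qlmul_bop H (w i) *o X i j +
    X i j *o qlmul_bop H (qconj (w j))) (d j)) (d i) =
    - (2 * reinner (J (\sum_i v i)) (adjoint M (\sum_i v i))).
  rewrite mulr_natl mulr2n -{1}sumJM -sumMJ -big_split -sumrN.
  apply: eq_bigr => i _; rewrite -big_split -sumrN.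
  by apply: eq_bigr => j _; apply: term.
by rewrite oppr_ge0 pmulr_rle0// block_dissipative.
Qed.

End Realization.

(** The coefficients [a i] are absorbed into the vectors [c i]. *)
Lemma positive_definite_of_adjoint (R : realType) (H : twoSidedQHilbertType R)
    (E : set (quat R)) (K : quat R -> quat R -> bop H H) :
  (forall p q, E p -> E q -> adjoint (K p q) = K q p) ->
  (forall N (w : 'I_N -> quat R) (c : 'I_N -> H), (forall i, E (w i)) ->
     0 <= \sum_i \sum_j reinner (K (w i) (w j) (c j)) (c i)) ->
  positive_definite E K.
Proof.
move=> Kadj Kge0 N w c wE.
have herm i j (u v : H) : inner (K (w i) (w j) u) v =
    qconj (inner (K (w j) (w i) v) u).
  by rewrite -inner_conj adjointP Kadj.
split=> [i j|a]; first by rewrite !mxE herm.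
pose d i := qrmul (c i) (a i).
have -> : \sum_i \sum_j qconj (a i) *
    (\matrix_(i, j) inner (K (w i) (w j) (c j)) (c i)) i j * a j =
    \sum_i \sum_j inner (K (w i) (w j) (d j)) (d i).
  apply: eq_bigr => i _; apply: eq_bigr => j _.
  by rewrite mxE /d bop_qrmul inner_qrmulr inner_qrmull mulrA.
set s := \sum_i _; split.
  by rewrite /s qre_sum; under eq_bigr do rewrite qre_sum; apply: Kge0.
have qconj_sum (I : Type) (r : seq I) (P : pred I) (G : I -> quat R) :
    qconj (\sum_(i <- r | P i) G i) = \sum_(i <- r | P i) qconj (G i).
  apply: (big_morph _ (@qconjD R)).
  by apply: quatP => /=; rewrite ?oppr0.
have : qconj s = s.
  rewrite /s [RHS]exchange_big qconj_sum; apply: eq_bigr => i _.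
  by rewrite qconj_sum; apply: eq_bigr => j _; rewrite -herm.
case: s => x y z t [Ey Ez Et].
by apply: quatP => /=; lra.
Qed.

Theorem theorem8p7 (R : realType) (H : twoSidedQHilbertType R)
    (H1 : rightQHilbertType R)
    (A : bop H1 H1) (B : bop H H1) (C : bop H1 H) (D : bop H H)
    (Omega : set (quat R)) (Phi : quat R -> bop H H) :
  axially_symmetric Omega -> s_domain Omega -> Omega 0 ->
  slice_hyperholomorphic Omega Phi ->
  realization Omega Phi A B C D ->
  bop_le0 (bop_re
    (bop_block A B C D *o bop_block (bop_id H1) 0 0 (- bop_id H))) ->
  positive_function Omega Phi.
Proof.
move=> _ _ _ _ PhiE MJ_le0; apply: positive_definite_of_adjoint.
  by move=> p q [_ p0] [_ q0]; apply: kernel_Phi_adjoint.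
by move=> N w c; apply: (kernel_Phi_ge0 MJ_le0 PhiE).
Qed.
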